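(* Let $\Delta$ be a simplicial complex on a finite vertex set $V$. The binoid $M_\Delta$ is finitely generated by $\#V$ elements, semifree, and reduced. Conversely, every commutative binoid $M$ that is finitely generated, semifree and reduced is a simplicial binoid, i.e. isomorphic to $M_{\Delta}$ for some simplicial complex $\Delta$. More precisely, $M\cong M_\Delta$, where $\Delta:=\{F\subseteq W\mid \sum_{w\in F}w\neq\infty\}$ for a minimal generating set $W$ of $M$.
   Context: A commutative binoid is a commutative monoid $(M,+,0)$ with an absorbing element $\infty$ ($a+\infty=\infty$); homomorphisms are monoid homomorphisms with $\infty\mapsto\infty$. A subset $A\subseteq M$ generates $M$ if the smallest submonoid containing $A\cup\{\infty\}$ is $M$; it is a minimal generating set if no proper subset generates $M$. A nonzero ($0\neq\infty$) commutative binoid $M$ is semifree if it has a generating set $\{a_i\mid i\in I\}$ such that every $f\in M\setminus\{\infty\}$ can be written uniquely as $f=\sum_{i\in I}n_ia_i$ with $n_i\in\mathbb N$, almost all $0$. $M$ is reduced if $na=\infty$ for some $n\ge1$ implies $a=\infty$. A simplicial complex on a finite set $V$ is a collection $\Delta$ of subsets of $V$ that is closed under taking subsets and contains $\emptyset$ and all singletons $\{v\}$, $v\in V$. The free commutative binoid on $V$ is $\mathbb N^V\cup\{\infty\}$, with elements $f=\sum_{v}n_vv\neq\infty$ of support $\operatorname{supp}(f)=\{v\mid n_v\neq0\}$; $M_\Delta$ is its quotient obtained by identifying with $\infty$ all $f$ with $\operatorname{supp}(f)\notin\Delta$ (and nothing else). *)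

(* Defs.v *)
From HB Require Import structures.
From mathcomp Require Import all_boot all_order all_algebra.
From mathcomp Require Import finmap generic_quotient classical_sets.

Set Implicit Arguments.
Unset Strict Implicit.
Unset Printing Implicit Defensive.

Import GRing.Theory.
Local Open Scope ring_scope.
Local Open Scope classical_set_scope.

HB.mixin Record Nmodule_isComBinoid M of GRing.Nmodule M := {
  binfty : M;
  addr_binfty : forall a : M, a + binfty = binfty
}.

#[short(type="comBinoidType")]
HB.structure Definition ComBinoid :=
  {M of Nmodule_isComBinoid M & GRing.Nmodule M}.

Notation "'∞'" := (@binfty _) : ring_scope.

Definition binoid_iso (M N : comBinoidType) : Prop :=
  exists f : {additive M -> N}, f ∞ = ∞ /\ bijective f.

Section Generation.
Variable M : comBinoidType.
Implicit Types A W : set M.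

Definition submonoid : set (set M) :=
  [set S | S 0 /\ forall a b, S a -> S b -> S (a + b)].

Definition generates A : Prop :=
  smallest submonoid (A `|` [set ∞]) = [set: M].

Definition minimal_generating W : Prop :=
  generates W /\ forall A, A `<` W -> ~ generates A.

End Generation.

Definition generated_by_card (M : comBinoidType) (n : nat) : Prop :=
  exists A : {fset M}, #|` A| = n /\ generates [set` A].

Definition finitely_generated (M : comBinoidType) : Prop :=
  exists n, generated_by_card M n.

(* [n : {fsfun I -> nat with 0%N}] is a family of natural numbers indexed by I,
   almost all of which are 0. *)
Definition semifree (M : comBinoidType) : Prop :=
  (0 : M) <> ∞ /\
  exists (I : choiceType) (a : I -> M),
    generates (range a) /\
    forall f : M, f <> ∞ ->
      exists! n : {fsfun I -> nat with 0%N},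
        f = \sum_(i <- finsupp n) a i *+ n i.

Definition reduced (M : comBinoidType) : Prop :=
  forall (a : M) (n : nat), (1 <= n)%N -> a *+ n = ∞ -> a = ∞.

Record simplicial_complex (V : finType) := SimplicialComplex {
  faces :> {set {set V}};
  faces_sub : forall F G : {set V}, F \in faces -> G \subset F -> G \in faces;
  faces0 : finset.set0 \in faces;
  faces1 : forall v : V, finset.set1 v \in faces
}.

Section FreeBinoid.
Variable V : finType.

(* [None] is ∞ and [Some n] is the element \sum_v n_v v. *)
Definition free_binoid := option {ffun V -> nat}.

HB.instance Definition _ := Choice.on free_binoid.

Definition free_add (f g : free_binoid) : free_binoid :=
  if f is Some n then if g is Some m then Some (n + m) else None else None.

Fact free_addA : associative free_add.
Proof. by move=> [f|] [g|] [h|] //=; rewrite addrA. Qed.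

Fact free_addC : commutative free_add.
Proof. by move=> [f|] [g|] //=; rewrite addrC. Qed.

Fact free_add0 : left_id (Some 0 : free_binoid) free_add.
Proof. by move=> [f|] //=; rewrite add0r. Qed.

HB.instance Definition _ :=
  GRing.isNmodule.Build free_binoid free_addA free_addC free_add0.

Fact free_addinfty (f : free_binoid) : f + (None : free_binoid) = None.
Proof. by case: f. Qed.

HB.instance Definition _ :=
  Nmodule_isComBinoid.Build free_binoid free_addinfty.

Definition supp (n : {ffun V -> nat}) : {set V} := [set v | n v != 0%N]%SET.

End FreeBinoid.

Section SimplicialBinoid.
Variables (V : finType) (D : simplicial_complex V).

Definition collapsed (f : free_binoid V) : bool :=
  if f is Some n then supp n \notin D else true.

Definition simplicial_rel (f g : free_binoid V) : bool :=
  (f == g) || collapsed f && collapsed g.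

Fact simplicial_rel_refl : reflexive simplicial_rel.
Proof. by move=> f; rewrite /simplicial_rel eqxx. Qed.

Fact simplicial_rel_sym : symmetric simplicial_rel.
Proof. by move=> f g; rewrite /simplicial_rel eq_sym andbC. Qed.

Fact simplicial_rel_trans : transitive simplicial_rel.
Proof.
move=> g f h /orP[/eqP-> // | /andP[Cf Cg]] /orP[/eqP<- | /andP[_ Ch]].
  by rewrite /simplicial_rel Cf Cg orbT.
by rewrite /simplicial_rel Cf Ch orbT.
Qed.

Canonical simplicial_equiv :=
  EquivRel simplicial_rel simplicial_rel_refl simplicial_rel_sym
    simplicial_rel_trans.

Fact collapsedD f g : collapsed f -> collapsed (f + g).
Proof.
case: f g => [n|] [m|] //=; apply: contra => Dnm; apply: faces_sub Dnm _.
by apply/fintype.subsetP=> v; rewrite !inE ffunE addn_eq0 negb_and => ->.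
Qed.

Fact simplicial_relD f f' g g' :
  simplicial_rel f f' -> simplicial_rel g g' ->
  simplicial_rel (f + g) (f' + g').
Proof.
move=> /orP[/eqP-> | /andP[Cf Cf']] /orP[/eqP-> | /andP[Cg Cg']].
- exact: simplicial_rel_refl.
- by rewrite /simplicial_rel ![f' + _]addrC !collapsedD ?orbT.
- by rewrite /simplicial_rel !collapsedD ?orbT.
- by rewrite /simplicial_rel !collapsedD ?orbT.
Qed.

Local Open Scope quotient_scope.

Definition simplicial_binoid := {eq_quot simplicial_rel}.

HB.instance Definition _ := Choice.on simplicial_binoid.
HB.instance Definition _ := EqQuotient.on simplicial_binoid.

Definition sb_add (x y : simplicial_binoid) : simplicial_binoid :=
  \pi_simplicial_binoid (repr x + repr y).

Fact sb_addE f g :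
  sb_add (\pi f) (\pi g) = \pi_simplicial_binoid (f + g).
Proof.
by apply/eqmodP; apply: simplicial_relD; apply/eqmodP; rewrite reprK.
Qed.

Fact sb_addA : associative sb_add.
Proof.
by elim/quotW=> f; elim/quotW=> g; elim/quotW=> h; rewrite !sb_addE addrA.
Qed.

Fact sb_addC : commutative sb_add.
Proof. by elim/quotW=> f; elim/quotW=> g; rewrite !sb_addE addrC. Qed.

Fact sb_add0 : left_id (\pi_simplicial_binoid 0) sb_add.
Proof. by elim/quotW=> f; rewrite sb_addE add0r. Qed.

HB.instance Definition _ :=
  GRing.isNmodule.Build simplicial_binoid sb_addA sb_addC sb_add0.

Fact sb_addinfty (x : simplicial_binoid) :
  x + \pi_simplicial_binoid ∞ = \pi_simplicial_binoid ∞.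
Proof. by elim/quotW: x => f; rewrite [LHS]sb_addE addr_binfty. Qed.

HB.instance Definition _ :=
  Nmodule_isComBinoid.Build simplicial_binoid sb_addinfty.

End SimplicialBinoid.

(* Main.v *)
(** In a semifree binoid the exponents of the unique expansion are additive on
    sums different from [∞], so the basis elements different from [∞] are
    irreducible.  They therefore lie in every generating set and form the
    unique minimal one, which is finite as soon as some generating set is.
    Evaluation of the free binoid on this set [X] at its own elements is
    surjective, injective away from the fibre of [∞], and, for a reduced
    binoid, sends [f] to [∞] exactly when the sum over the support of [f] is
    [∞]; hence it induces the isomorphism with the simplicial binoid. *)
Require Import Defs.
From HB Require Import structures.
From mathcomp Require Import all_boot all_order all_algebra.
From mathcomp Require Import finmap generic_quotient boolp classical_sets.

Set Implicit Arguments.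
Unset Strict Implicit.
Unset Printing Implicit Defensive.

Import GRing.Theory.

Local Open Scope ring_scope.
Local Open Scope classical_set_scope.

(** * Submonoids and generation in a commutative binoid *)

Lemma add_binftyr (M : comBinoidType) (a : M) : ∞ + a = ∞.
Proof. by rewrite addrC addr_binfty. Qed.

Lemma submonoid_sum (M : comBinoidType) (S : set M) (I : Type) (r : seq I)
    (P : pred I) (F : I -> M) :
  submonoid S -> (forall i, P i -> S (F i)) -> S (\sum_(i <- r | P i) F i).
Proof. by move=> [S0 SD] SF; apply: big_ind. Qed.

Lemma submonoidMn (M : comBinoidType) (S : set M) (x : M) n :
  submonoid S -> S x -> S (x *+ n).
Proof.
move=> [S0 SD] Sx; elim: n => [|n IHn]; first by rewrite mulr0n.
by rewrite mulrS; apply: SD.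
Qed.

Lemma generatesP (M : comBinoidType) (A : set M) :
  generates A <->
  forall S, submonoid S -> A `<=` S -> S ∞ -> forall x, S x.
Proof.
split=> [gA S Ssub AS Soo x | gA].
  have : [set: M] x by [].
  rewrite -gA; apply; split=> // y [/AS // | /= ->//].
apply/seteqP; split=> // x _ S [Ssub AS]; apply: gA => // [y Ay|].
  by apply: AS; left.
by apply: AS; right.
Qed.

Lemma binoid_iso_of (M N : comBinoidType) (f : M -> N) :
  GRing.nmod_morphism f -> f ∞ = ∞ -> bijective f -> binoid_iso M N.
Proof.
move=> fD foo fbij.
pose F : {additive M -> N} :=
  HB.pack_for {additive M -> N} f (GRing.isNmodMorphism.Build M N f fD).
by exists F.
Qed.

(** * Simplicial binoids: generators, semifreeness, reducedness *)

Section SimplicialBinoidTheory.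
Variables (V : finType) (D : simplicial_complex V).
Local Notation MD := (simplicial_binoid D).
Local Open Scope quotient_scope.

Definition sb_mono (n : {ffun V -> nat}) : MD :=
  \pi_MD (Some n : free_binoid V).

Lemma sb_mono0 : sb_mono 0 = 0. Proof. by []. Qed.

Lemma sb_monoD : {morph sb_mono : n m / n + m}.
Proof. by move=> n m; rewrite [RHS]sb_addE. Qed.

Lemma sb_monoMn n k : sb_mono (n *+ k) = sb_mono n *+ k.
Proof.
elim: k => [|k IHk]; first by rewrite !mulr0n.
by rewrite !mulrS sb_monoD IHk.
Qed.

Lemma sb_mono_eq n m :
  (sb_mono n == sb_mono m) = (n == m) || (supp n \notin D) && (supp m \notin D).
Proof. exact: eqmodE. Qed.

Lemma sb_mono_infty n : (sb_mono n == ∞) = (supp n \notin D).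
Proof. by rewrite [LHS]eqmodE /= /simplicial_rel /= andbT. Qed.

Lemma sb_monoP (x : MD) : x <> ∞ -> exists2 n, supp n \in D & x = sb_mono n.
Proof.
elim/quotW: x => -[n noo|//]; exists n => //.
by apply/negPn; rewrite -sb_mono_infty; apply/eqP.
Qed.

Definition unit_ffun (v : V) : {ffun V -> nat} := [ffun u => (u == v) : nat].

Definition sb_vertex v : MD := sb_mono (unit_ffun v).

Lemma supp_unit_ffun v : supp (unit_ffun v) = [set v]%SET.
Proof. by apply/setP=> u; rewrite !inE ffunE eqb0 negbK. Qed.

(** Singletons are faces, so no vertex collapses to [∞]; this makes the number of generators exactly
    [#|V|]. *)
Lemma sb_vertex_inj : injective sb_vertex.
Proof.
move=> u v /eqP; rewrite sb_mono_eq !supp_unit_ffun !faces1 orbF.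
move=> /eqP/ffunP/(_ u); rewrite !ffunE eqxx.
by case: (u =P v).
Qed.

Lemma sb_mono_sum n : sb_mono n = \sum_v sb_vertex v *+ n v.
Proof.
under eq_bigr => v _ do rewrite -sb_monoMn.
rewrite -(big_morph sb_mono sb_monoD sb_mono0); congr sb_mono.
apply/ffunP=> u; rewrite sum_ffunE (bigD1 u) //= big1 ?addr0 => [|v vu].
  by rewrite ffunMnE ffunE eqxx -mulr_natr mul1r natn.
by rewrite ffunMnE ffunE eq_sym (negPf vu) mul0rn.
Qed.

Lemma sb_vertex_generates (A : set MD) :
  (forall v, A (sb_vertex v)) -> generates A.
Proof.
move=> Av; apply/generatesP => S Ssub AS Soo x.
have [->//|xoo] := pselect (x = ∞).
have [n _ ->] := sb_monoP xoo; rewrite sb_mono_sum.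
by apply: submonoid_sum => // v _; apply: submonoidMn => //; apply/AS/Av.
Qed.

Lemma sb_generated_by_card : generated_by_card MD #|V|.
Proof.
exists [fset sb_vertex v | v in {: V}]%fset; split.
  by rewrite card_imfset ?cardE; [|exact: sb_vertex_inj].
by apply: sb_vertex_generates => v /=; apply: in_imfset.
Qed.

Lemma sb_sum_fsfun (n : {fsfun V -> nat with 0%N}) :
  \sum_(v <- finsupp n) sb_vertex v *+ n v = sb_mono [ffun v => n v].
Proof.
rewrite sb_mono_sum.
under [RHS]eq_bigr => v _ do rewrite ffunE.
rewrite [RHS](bigID (mem (finsupp n))) /= [X in _ + X]big1 ?addr0 => [|v vn].
  rewrite -[RHS]big_filter; apply: perm_big; apply: uniq_perm.
  - exact: fset_uniq.
  - by rewrite filter_uniq ?index_enum_uniq.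
  - by move=> v; rewrite mem_filter mem_index_enum andbT.
by rewrite fsfun_dflt.
Qed.

(** A monomial supported on a face is identified with no other one, so expansions over the vertices
    stay unique; the empty face gives [0 <> ∞]. *)
Lemma sb_semifree : semifree MD.
Proof.
split.
  apply/eqP; rewrite -sb_mono0 sb_mono_infty negbK.
  suff -> : supp 0 = finset.set0 :> {set V} by exact: faces0.
  by apply/setP=> v; rewrite !inE ffunE eqxx.
exists V, sb_vertex; split; first by apply: sb_vertex_generates => v; exists v.
move=> x /sb_monoP[n nD ->].
exists [fsfun v in [fset u | u in {: V}]%fset => n v]; split.
  rewrite sb_sum_fsfun; congr sb_mono.
  by apply/ffunP=> v; rewrite ffunE fsfunE in_imfset.
move=> m; rewrite sb_sum_fsfun => /eqP.
rewrite sb_mono_eq nD orbF => /eqP nm.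
by apply/fsfunP=> v; rewrite fsfunE in_imfset // nm ffunE.
Qed.

(** Positive multiples have the same support, and the support alone decides whether a monomial
    collapses. *)
Lemma sb_reduced : reduced MD.
Proof.
move=> x k k1 xk; have [//|/sb_monoP[n nD xE]] := pselect (x = ∞).
move: xk; rewrite xE -sb_monoMn => /eqP; rewrite sb_mono_infty.
suff -> : supp (n *+ k) = supp n by rewrite nD.
apply/setP=> v; rewrite !inE ffunMnE -mulr_natr natn muln_eq0.
by rewrite [(k == 0)%N]eqn0Ngt k1 orbF.
Qed.

End SimplicialBinoidTheory.

(* The exponents of the unique expansion; their values at [∞] are junk. *)
Lemma semifree_coords (M : comBinoidType) (I : choiceType) (a : I -> M) :
  (forall f : M, f <> ∞ ->
     exists! n : {fsfun I -> nat with 0%N},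
       f = \sum_(i <- finsupp n) a i *+ n i) ->
  exists c : M -> I -> nat,
    [/\ forall x, x <> ∞ -> (forall i, c x i = 0%N) -> x = 0,
        forall x y, x + y <> ∞ -> forall i, c (x + y) i = (c x i + c y i)%N &
        forall i j, a j <> ∞ -> c (a j) i = (i == j)].
Proof.
move=> a_free.
pose expansion x (n : {fsfun I -> nat with 0%N}) :=
  x = \sum_(i <- finsupp n) a i *+ n i.
have [c cP] : {c : M -> {fsfun I -> nat with 0%N} &
    forall x, x <> ∞ -> unique (expansion x) (c x)}.
  apply: (choice (P := fun x n => x <> ∞ -> unique (expansion x) n)) => x.
  have [->|/a_free[n nP]] := pselect (x = ∞); last by exists n.
  by exists [fsfun].
have sum_sub (n : {fsfun I -> nat with 0%N}) (A : {fset I}) :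
    (finsupp n `<=` A)%fset ->
    \sum_(i <- finsupp n) a i *+ n i = \sum_(i <- A) a i *+ n i.
  by move=> nA; apply: big_fset_incl => // i _ /fsfun_dflt ->.
exists (fun x i => c x i); split=> [x xoo c0 | x y xyoo i | i j ajoo].
- by rewrite [LHS](cP _ xoo).1 big1 // => i _; rewrite c0.
- have xoo : x <> ∞ by move=> xE; apply: xyoo; rewrite xE add_binftyr.
  have yoo : y <> ∞ by move=> yE; apply: xyoo; rewrite yE addr_binfty.
  pose A := (finsupp (c x) `|` finsupp (c y))%fset.
  pose n : {fsfun I -> nat with 0%N} := [fsfun k in A => (c x k + c y k)%N].
  have nE k : n k = (c x k + c y k)%N.
    rewrite fsfunE; case: ifPn => //; rewrite in_fsetU negb_or.
    by move=> /andP[/fsfun_dflt -> /fsfun_dflt ->].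
  (* The pointwise sum [n] also expands [x + y], so uniqueness identifies the two. *)
  suff -> : c (x + y) = n by [].
  apply: (cP _ xyoo).2; rewrite /expansion (sum_sub n A); last first.
    by apply/fsubsetP=> k; rewrite mem_finsupp fsfunE; case: ifP.
  rewrite {1}(cP _ xoo).1 {1}(cP _ yoo).1.
  rewrite (sum_sub _ A) ?fsubsetUl // (sum_sub (c y) A) ?fsubsetUr //.
  by rewrite -big_split; apply: eq_bigr => k _; rewrite nE mulrnDr.
- pose n : {fsfun I -> nat with 0%N} := [fsfun k in [fset j]%fset => 1%N].
  have nE k : n k = (k == j) by rewrite fsfunE in_fset1; case: eqP.
  rewrite -nE; congr (fun_of_fsfun _ i); apply: (cP _ ajoo).2.
  rewrite /expansion (sum_sub n [fset j]%fset) ?big_seq_fset1 ?nE ?eqxx //.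
  by apply/fsubsetP=> k; rewrite mem_finsupp nE in_fset1; case: (k == j).
Qed.

(** A semifree family may contain [∞], but a minimal generating set cannot, since generation adjoins
    [∞] anyway. *)
Definition basis_elements (M : comBinoidType) (I : choiceType) (a : I -> M) :
  set M := range a `\ ∞.

(** * Irreducible basis elements and minimal generating sets *)

Section SemifreeTheory.
Variables (M : comBinoidType) (I : choiceType) (a : I -> M) (c : M -> I -> nat).
Hypothesis zero_fin : (0 : M) <> ∞.
Hypothesis c_eq0 : forall x, x <> ∞ -> (forall i, c x i = 0%N) -> x = 0.
Hypothesis cD :
  forall x y, x + y <> ∞ -> forall i, c (x + y) i = (c x i + c y i)%N.
Hypothesis c_basis : forall i j, a j <> ∞ -> c (a j) i = (i == j).

Lemma addr_fin (x y : M) : x + y <> ∞ -> x <> ∞ /\ y <> ∞.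
Proof.
move=> xyoo; split=> E; apply: xyoo; first by rewrite E add_binftyr.
by rewrite E addr_binfty.
Qed.

Lemma coord0 i : c 0 i = 0%N.
Proof.
have := @cD 0 0; rewrite addr0 => /(_ zero_fin i)/eqP.
by rewrite -{1}[c 0 i]addn0 eqn_add2l => /eqP.
Qed.

(* Basis elements are irreducible, so the complement of one is a submonoid. *)
Lemma basis_sub_generating A : generates A -> basis_elements a `<=` A.
Proof.
move=> /generatesP gA _ [[j _ <-] ajoo].
apply: contrapT => Aj; apply: (gA [set x | x <> a j]) => //; last first.
- by move=> E; apply: ajoo.
- by move=> x Ax E; apply: Aj; rewrite -E.
split=> [E|x y /= xaj yaj xyE].
  by have := c_basis j ajoo; rewrite -E coord0 eqxx.
have xyoo : x + y <> ∞ by rewrite xyE.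
have [xoo yoo] := addr_fin xyoo.
have cxy i : (c x i + c y i)%N = (i == j) by rewrite -cD // xyE c_basis.
(* The coordinates of [x] and [y] add up to the indicator of [j]. Whichever of the two has
   coordinate 0 at [j] has all coordinates 0, so it is 0 and the other equals [a j]. *)
have c_out z i : (c z i <= (i == j))%N -> c z j = 0%N -> c z i = 0%N.
  by case: eqP => [-> _ -> //| _]; rewrite leqn0 => /eqP.
have [cx0|cx0] := posnP (c x j).
  apply: yaj; rewrite -xyE (c_eq0 xoo) ?add0r // => i.
  by apply: c_out => //; rewrite -cxy leq_addr.
apply: xaj; rewrite -xyE (c_eq0 yoo) ?addr0 // => i.
apply: c_out; first by rewrite -cxy leq_addl.
move: (cxy j) cx0; rewrite eqxx; case: (c x j) => // n [/eqP].
by rewrite addn_eq0 => /andP[_ /eqP].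
Qed.

Lemma basis_generates : generates (range a) -> generates (basis_elements a).
Proof.
move=> /generatesP ga; apply/generatesP => S Ssub BS Soo; apply: ga => // x ax.
by have [->//|xoo] := pselect (x = ∞); apply: BS.
Qed.

Lemma basis_minimal_generating :
  generates (range a) -> minimal_generating (basis_elements a).
Proof.
move=> /basis_generates gB; split=> // A [AB BA] /basis_sub_generating.
exact: BA.
Qed.

(** [W] contains the basis, which itself generates, so minimality excludes a proper inclusion. *)
Lemma minimal_generating_eq W :
  generates (range a) -> minimal_generating W -> W = basis_elements a.
Proof.
move=> /basis_generates gB [gW Wmin].
have BW := basis_sub_generating gW.
apply: contrapT => WB; apply: (Wmin _ _ gB); split=> // WB'.
by apply: WB; apply/seteqP.
Qed.

(** * Evaluation of the free binoid on a finite basis *)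

Variable X : {fset M}.
Hypothesis X_basis : [set` X] = basis_elements a.

Lemma basis_index (w : X) : exists2 i, fsval w = a i & a i <> ∞.
Proof.
have : [set` X] (fsval w) by exact: fsvalP.
by rewrite X_basis => -[[i _ <-] aioo]; exists i.
Qed.

Definition evalf (f : free_binoid X) : M :=
  if f is Some n then \sum_w fsval w *+ n w else ∞.

Lemma evalf0 : evalf 0 = 0.
Proof. by rewrite /evalf /= big1 // => w _; rewrite ffunE. Qed.

Lemma evalfD : {morph evalf : f g / f + g}.
Proof.
move=> [n|] [m|] /=; rewrite ?addr_binfty ?add_binftyr //.
by rewrite -big_split; apply: eq_bigr => w _; rewrite ffunE mulrnDr.
Qed.

(** The image of evaluation is a submonoid containing [X] and [∞]. *)
Lemma evalf_surj : generates [set` X] -> forall x, exists f, evalf f = x.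
Proof.
move=> /generatesP gX; apply: (gX [set x | exists f, evalf f = x]).
- split; first by exists 0; apply: evalf0.
  by move=> _ _ [f <-] [g <-]; exists (f + g); rewrite evalfD.
- move=> x /= Xx; exists (Some (unit_ffun [` Xx]%fset)) => /=.
  rewrite (bigD1 [` Xx]%fset) //= ffunE eqxx mulr1n big1 ?addr0 // => w wx.
  by rewrite ffunE (negPf wx).
- by exists None.
Qed.

Lemma coord_sum (J : Type) (r : seq J) (F : J -> M) i :
  \sum_(j <- r) F j <> ∞ ->
  c (\sum_(j <- r) F j) i = (\sum_(j <- r) c (F j) i)%N.
Proof.
elim: r => [|j r IHr]; first by rewrite !big_nil coord0.
by rewrite !big_cons => s; rewrite cD // IHr //; have [] := addr_fin s.
Qed.

Lemma coordMn x n i : x *+ n <> ∞ -> c (x *+ n) i = (c x i * n)%N.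
Proof.
elim: n => [|n IHn]; first by rewrite coord0 muln0.
by rewrite mulrS => s; rewrite cD // IHn ?mulnS //; have [] := addr_fin s.
Qed.

Lemma sumr_fin (J : Type) (r : seq J) (P : pred J) (F : J -> M) :
  \sum_(j <- r | P j) F j <> ∞ ->
  forall S : pred J, \sum_(j <- r | P j && S j) F j <> ∞.
Proof. by move=> s S; move: s; rewrite (bigID S) /= => /addr_fin[]. Qed.

(** At the index of [w] only the summand of [w] can contribute, so coordinates recover the exponents
    wherever the value is not [∞]. *)
Lemma coord_evalf (n : {ffun X -> nat}) (w : X) i :
  fsval w = a i -> evalf (Some n) <> ∞ -> c (evalf (Some n)) i = n w.
Proof.
move=> wi noo; rewrite /evalf coord_sum // (bigD1 w) //= big1 => [|u uw].
  have := noo; rewrite /= (bigD1 w) //= => /addr_fin[wn _].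
  have [k wk akoo] := basis_index w.
  by rewrite addn0 coordMn // wi c_basis ?eqxx ?mul1n // -wi wk.
have := noo; rewrite /= (bigD1 u) //= => /addr_fin[un _].
have [k uk akoo] := basis_index u.
(* Equal indices would force [u] and [w] to be the same element of [M]. *)
rewrite coordMn // uk c_basis //; case: eqP => // ik.
by case/eqP: uw; apply: val_inj; rewrite /= uk wi ik.
Qed.

Lemma evalf_inj (n m : {ffun X -> nat}) :
  evalf (Some n) <> ∞ -> evalf (Some n) = evalf (Some m) -> n = m.
Proof.
move=> noo nm; apply/ffunP=> w; have [i wi _] := basis_index w.
by rewrite -(coord_evalf wi noo) nm (coord_evalf wi) // -nm.
Qed.

(** * The complex of the sets with sum different from [∞], and the isomorphism *)

Definition nonvanishing_sets : {set {set X}} :=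
  [set F : {set X} | \sum_(w in F) fsval w != ∞]%SET.

Lemma nonvanishing_sub (F G : {set X}) :
  F \in nonvanishing_sets -> G \subset F -> G \in nonvanishing_sets.
Proof.
rewrite !inE => /eqP Foo /finset.setIidPr <-; apply/eqP.
under eq_bigl do rewrite inE.
exact: sumr_fin.
Qed.

Lemma nonvanishing0 : finset.set0 \in nonvanishing_sets.
Proof. by rewrite inE big_set0; apply/eqP. Qed.

Lemma nonvanishing1 (w : X) : finset.set1 w \in nonvanishing_sets.
Proof.
by rewrite inE big_set1; have [i -> ?] := basis_index w; apply/eqP.
Qed.

Definition nonvanishing_complex : simplicial_complex X :=
  SimplicialComplex nonvanishing_sub nonvanishing0 nonvanishing1.

(* If [\sum_w n_w w = ∞], then so is the larger [N (\sum_(n_w > 0) w)] for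
   [N] at least all [n_w], and reducedness removes the factor [N]. *)
Lemma evalf_collapsed (f : free_binoid X) :
  reduced M -> collapsed nonvanishing_complex f = (evalf f == ∞).
Proof.
case: f => [n|] red; last by rewrite /= eqxx.
rewrite /collapsed inE negbK /evalf.
pose R := \sum_(w in supp n) fsval w; rewrite -/R.
have nE : \sum_w fsval w *+ n w = \sum_(w in supp n) fsval w *+ n w.
  rewrite (bigID (mem (supp n))) /= [X in _ + X]big1 ?addr0 // => w.
  by rewrite inE negbK => /eqP ->.
apply/eqP/eqP => [Roo | noo].
  (* One copy of each [w] in the support splits off, so [R] is a summand and absorbs the rest. *)
  have -> : \sum_w fsval w *+ n w = R + \sum_(w in supp n) fsval w *+ (n w).-1.
    rewrite nE -big_split; apply: eq_bigr => w; rewrite inE -lt0n => n0.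
    by rewrite /= -mulrS prednK.
  by rewrite Roo add_binftyr.
(* The successor makes [N] positive, as reducedness requires. *)
pose N := (\sum_w n w).+1; apply: (red _ N) => //.
have nN w : (n w <= N)%N.
  by apply: leqW; rewrite (bigD1 w) //= leq_addr.
have -> : R *+ N =
    \sum_w fsval w *+ n w + \sum_(w in supp n) fsval w *+ (N - n w).
  rewrite nE -big_split -sumrMnl; apply: eq_bigr => w _ /=.
  by rewrite -mulrnDr subnKC.
by rewrite noo add_binftyr.
Qed.

(** The relation defining the simplicial binoid is the kernel of the surjective evaluation. *)
Lemma nonvanishing_iso :
  generates (range a) -> reduced M ->
  binoid_iso M (simplicial_binoid nonvanishing_complex).
Proof.
move=> ga red.
have relE f g : simplicial_rel nonvanishing_complex f g <-> evalf f = evalf g.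
  rewrite /simplicial_rel !evalf_collapsed //; split.
    by case/orP=> [/eqP-> // | /andP[/eqP-> /eqP->]].
  have [foo <- | foo] := eqVneq (evalf f) ∞; first by rewrite foo eqxx orbT.
  rewrite orbF; case: f g foo => [n|] [m|] /= /eqP foo //.
  by move=> /evalf_inj -> //.
have piE f g :
    \pi_(simplicial_binoid nonvanishing_complex)%qT f = \pi%qT g <->
    evalf f = evalf g.
  by split=> [/eqmodP/relE // | /relE/eqmodP].
have gX : generates [set` X] by rewrite X_basis; apply: basis_generates.
(* The section [h] need not be additive; its class in the quotient is independent of the choice, so
   [phi] is. *)
have [h hK] := choice (evalf_surj gX).
pose phi x : simplicial_binoid nonvanishing_complex := \pi%qT (h x).
apply: (@binoid_iso_of _ _ phi).
- split; first by apply/piE; rewrite hK evalf0.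
  by move=> x y; rewrite [RHS]sb_addE; apply/piE; rewrite evalfD !hK.
- by apply/piE; rewrite hK.
- exists (fun y => evalf (repr y)) => [x|y].
    by rewrite -[RHS]hK; apply/piE; rewrite reprK.
  by rewrite -[RHS]reprK; apply/piE; rewrite hK.
Qed.

End SemifreeTheory.

Theorem theorem6p5p8 :
  (forall (V : finType) (D : simplicial_complex V),
     [/\ generated_by_card (simplicial_binoid D) #|V|,
         semifree (simplicial_binoid D) &
         reduced (simplicial_binoid D)]) /\
  (forall M : comBinoidType,
     finitely_generated M -> semifree M -> reduced M ->
     [/\ exists (V : finType) (D : simplicial_complex V),
           binoid_iso M (simplicial_binoid D),
         exists W : set M, minimal_generating W &
         forall W : set M, minimal_generating W ->
           exists2 X : {fset M}, W = [set` X] &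
           exists2 D : simplicial_complex X,
             D = [set F : {set X} | \sum_(w in F) fsval w != ∞]%SET
               :> {set {set X}} &
             binoid_iso M (simplicial_binoid D)]).
Proof.
split=> [V D | M [_ [A [_ gA]]] [zero_fin [I [a [ga a_free]]]] red].
  by split; [exact: sb_generated_by_card|exact: sb_semifree|exact: sb_reduced].
have [c [c_eq0 cD c_basis]] := semifree_coords a_free.
have BA := basis_sub_generating zero_fin c_eq0 cD c_basis gA.
(* The basis lies in the finite set [A], so it can serve as a finite vertex set. *)
pose X := [fset x in A | `[< basis_elements a x >]]%fset.
have XB : [set` X] = basis_elements a.
  apply/seteqP; split=> x /=; rewrite !inE /=; first by case/andP=> _ /asboolP.
  by move=> Bx; apply/andP; split; [exact: BA | apply/asboolP].
have iso := nonvanishing_iso zero_fin cD c_basis XB ga red.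
split; first by do 2!eexists; exact: iso.
  exists (basis_elements a).
  exact: (basis_minimal_generating zero_fin c_eq0 cD c_basis ga).
(* The basis is the only minimal generating set, so one isomorphism serves every [W]. *)
move=> W /(minimal_generating_eq zero_fin c_eq0 cD c_basis ga) ->.
by exists X => //; eexists; last exact: iso.
Qed.
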